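(* Let $n\ge2$ be an integer and consider the $n$-player quantum volunteer's dilemma $G^{(n)}_{\mathrm{QVD}}$. Let $A=\left(0,\frac{\pi}{2}\right)\in\Theta$ and let $A^n=(A,A,\ldots,A)\in\Theta^n$. If the players adopt the strategy profile $A^n$, then every player volunteers with probability $1$ when $n$ is even, while every player abstains with probability $1$ when $n$ is odd, i.e. for all $x\in\{0,1\}^n$, $$p_{A^n}(x)=[n\text{ even}]\,[x=1^n]+[n\text{ odd}]\,[x=0^n],$$ and the corresponding payoff of each player $a\in[n]$ is $$\$_a(A^n)=\left(2-\frac1n\right)[n\text{ even}].$$ Moreover, (a) if $n$ is even, then $A^n$ is a Nash equilibrium of $G^{(n)}_{\mathrm{QVD}}$; and (b) if $n$ is odd, then $A^n$ is not a Nash equilibrium of $G^{(n)}_{\mathrm{QVD}}$.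
   Context: Notation: $[n]=\{1,\ldots,n\}$; $[P]$ is the Iverson bracket, equal to $1$ if $P$ is true and $0$ otherwise. For $x\in\{0,1\}^n$, $\mathrm{wt}(x)=|\{i\in[n]:x_i=1\}|$ is the Hamming weight, $\bar x$ is the bitwise complement ($\bar x_i=1-x_i$), and $0^n$, $1^n$ are the all-zeros and all-ones strings. Deterministic volunteer's dilemma payoffs: for $x\in\{0,1\}^n$ ($x_i=1$ means player $i$ volunteers, $x_i=0$ means player $i$ abstains), $\$_i^{\mathrm{VD}}(x)=2-\frac1{\mathrm{wt}(x)}$ if $x_i=1$, and $\$_i^{\mathrm{VD}}(x)=2\,[\mathrm{wt}(x)>0]$ if $x_i=0$. Quantum volunteer's dilemma $G^{(n)}_{\mathrm{QVD}}$: the $n$-player game in which every player's strategy set is $\Theta=[0,4\pi)\times[0,2\pi)$. Strategy $(\theta_i,\phi_i)\in\Theta$ means that player $i$ applies to qubit $i$ the unitary $$U(\theta_i,\phi_i)=\begin{pmatrix}e^{\mathrm i\phi_i}\cos(\theta_i/2)&\sin(\theta_i/2)\\-\sin(\theta_i/2)&e^{-\mathrm i\phi_i}\cos(\theta_i/2)\end{pmatrix}.$$ Let $J=e^{-\frac{\mathrm i\pi}{4}Y^{\otimes n}}=\frac1{\sqrt2}(I-\mathrm iY^{\otimes n})$ with $Y=\begin{pmatrix}0&-\mathrm i\\\mathrm i&0\end{pmatrix}$, and let $|x\rangle$, $x\in\{0,1\}^n$, be the computational basis of $(\mathbb C^2)^{\otimes n}$. For a strategy profile $(\theta,\phi)=((\theta_1,\phi_1),\ldots,(\theta_n,\phi_n))\in\Theta^n$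 and $x\in\{0,1\}^n$, the probability that exactly the players $i$ with $x_i=1$ volunteer is $$p_{\theta,\phi}(x)=\left|\langle\bar x|J^\dagger\Big(\bigotimes_{j=1}^nU(\theta_j,\phi_j)\Big)J|0\rangle^{\otimes n}\right|^2,$$ and the payoff function of player $i$ is $\$_i(\theta,\phi)=\sum_{x\in\{0,1\}^n}\$_i^{\mathrm{VD}}(x)\,p_{\theta,\phi}(x)$. For a profile $s=(\theta,\phi)$ write $p_s=p_{\theta,\phi}$ and $\$_i(s)=\$_i(\theta,\phi)$. Nash equilibrium: a profile $s=(s_1,\ldots,s_n)\in\Theta^n$ is a Nash equilibrium if for every player $i$ and every $t_i\in\Theta\setminus\{s_i\}$, $\$_i(s_1,\ldots,s_{i-1},s_i,s_{i+1},\ldots,s_n)\ge\$_i(s_1,\ldots,s_{i-1},t_i,s_{i+1},\ldots,s_n)$. *)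

(* Defs.v *)
From HB Require Import structures.
From mathcomp Require Import all_boot all_order all_algebra.
From mathcomp Require Import complex.
From mathcomp Require Import reals trigo.
From mathcomp Require Import lra.

Set Implicit Arguments.
Unset Strict Implicit.
Unset Printing Implicit Defensive.

Import Order.TTheory GRing.Theory Num.Theory.
Local Open Scope ring_scope.
Local Open Scope complex_scope.
Local Open Scope sesquilinear_scope.

Definition is_nash (n : nat) (S : eqType) (R : realType)
    (payoff : 'I_n -> ('I_n -> S) -> R) (s : 'I_n -> S) : Prop :=
  forall (i : 'I_n) (t : S), t != s i ->
    payoff i [eta s with i |-> t] <= payoff i s.

(* The bit x_i = 1 is encoded as true; the players are 0, ..., n-1. *)
Definition bitstring (n : nat) : finType := {ffun 'I_n -> bool}.

Definition bits_compl n (x : bitstring n) : bitstring n := [ffun i => ~~ x i].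
Definition bits0 n : bitstring n := [ffun => false].
Definition bits1 n : bitstring n := [ffun => true].
Definition wt n (x : bitstring n) : nat := #|[set i | x i]|.

Definition payoff_VD (R : realType) n (i : 'I_n) (x : bitstring n) : R :=
  if x i then 2 - (wt x)%:R^-1 else 2 * (0 < wt x)%N%:R.

Section QuantumVolunteersDilemma.
Variable R : realType.

(* The n-qubit space (C^2)^{(x) n} is modelled by column vectors whose
   coordinates are indexed by bitstrings, through enum_rank / enum_val. *)
Definition ket n (x : bitstring n) : 'cV[R[i]]_#|bitstring n| :=
  delta_mx (enum_rank x) 0.

Definition bit_ord (b : bool) : 'I_2 := if b then 1 else 0.

(* <x| (M_1 (x) ... (x) M_n) |y> = \prod_j <x_j| M_j |y_j> *)
Definition tensor n (M : 'I_n -> 'M[R[i]]_2) : 'M[R[i]]_#|bitstring n| :=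
  \matrix_(a, b) \prod_(j < n)
     M j (bit_ord ((enum_val a : bitstring n) j))
         (bit_ord ((enum_val b : bitstring n) j)).

Definition mx2 (a b c d : R[i]) : 'M[R[i]]_2 :=
  \matrix_(j < 2, k < 2)
    if j == 0 then (if k == 0 then a else b) else (if k == 0 then c else d).

Definition pauliY : 'M[R[i]]_2 := mx2 0 (- 'i%C) 'i%C 0.

(* e^{i t} for real t *)
Definition expi (t : R) : R[i] := cos t +i* sin t.

Definition Umx (theta phi : R) : 'M[R[i]]_2 :=
  mx2 (expi phi * (cos (theta / 2))%:C) (sin (theta / 2))%:C
      (- (sin (theta / 2))%:C)          (expi (- phi) * (cos (theta / 2))%:C).

(* e^{- i pi/4 Y^{(x) n}}, in closed form because Y^{(x) n} squares to 1 *)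
Definition Jmx n : 'M[R[i]]_#|bitstring n| :=
  ((Num.sqrt 2)^-1)%:C *: (1%:M - 'i%C *: tensor (fun _ : 'I_n => pauliY)).

Definition in_strategy_set (s : R * R) : bool :=
  (0 <= s.1 < 4 * pi) && (0 <= s.2 < 2 * pi).

Definition strategy : Type := {s : R * R | in_strategy_set s}.
HB.instance Definition _ := Equality.on strategy.

Definition amplitude n (s : 'I_n -> strategy) (x : bitstring n) : R[i] :=
  ((ket (bits_compl x))^t* *m (Jmx n)^t*
     *m tensor (fun j => Umx (val (s j)).1 (val (s j)).2)
     *m Jmx n *m ket (bits0 n)) 0 0.

Definition vol_prob n (s : 'I_n -> strategy) (x : bitstring n) : R :=
  ComplexField.Normc.normc (amplitude s x) ^+ 2.

Definition payoff_QVD n (i : 'I_n) (s : 'I_n -> strategy) : R :=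
  \sum_(x : bitstring n) payoff_VD R i x * vol_prob s x.

Lemma in_strategy_setA : in_strategy_set (0, pi / 2).
Proof. by have := pi_gt0 R; rewrite /in_strategy_set /=; lra. Qed.

Definition stratA : strategy := exist _ (0, pi / 2) in_strategy_setA.

Definition profileA n : 'I_n -> strategy := fun=> stratA.

End QuantumVolunteersDilemma.

Arguments stratA R : clear implicits.
Arguments profileA R n : clear implicits.

(* Main.v *)
(* Let everybody but one player play A, so that all other qubits undergo
   diag(i, -i) with i the imaginary unit. Since J|0...0> is a combination of
   |0...0> and |1...1>, and J^dagger only mixes |x> with its complement, every outcome x whose bits
   are not all equal off that player has amplitude 0. The four remaining outcomes
   carry the probabilities sin^2(theta/2), (cos phi cos(theta/2))^2,
   (sin phi cos(theta/2))^2 and 0, distributed according to the parity of n.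
   For even n the deviator earns sin^2(theta/2)
   + (2 - 1/n) sin^2(phi) cos^2(theta/2) <= 2 - 1/n; for odd n the deviation
   (0, 0) makes everybody volunteer and earns 2 - 1/n > 0. *)
Require Import Defs.
From mathcomp Require Import all_boot all_order all_algebra.
From mathcomp Require Import complex.
From mathcomp Require Import reals trigo.
From mathcomp Require Import ring lra.

Set Implicit Arguments.
Unset Strict Implicit.
Unset Printing Implicit Defensive.

Import Order.TTheory GRing.Theory Num.Theory.
Local Open Scope ring_scope.
Local Open Scope complex_scope.
Local Open Scope sesquilinear_scope.

(** * Bitstrings that are constant off one player *)

Lemma bits_complK n : involutive (@bits_compl n).
Proof. by move=> x; apply/ffunP => j; rewrite !ffunE negbK. Qed.

Lemma other_player n (i : 'I_n) : (2 <= n)%N -> exists j, j != i.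
Proof.
move=> n2; apply/existsP; apply: contraTT n2; rewrite negb_exists -ltnNge ltnS.
move/forallP=> alli; rewrite -[n]card_ord -(card1 i); apply: subset_leq_card.
by apply/subsetP => j _; exact: negbNE (alli j).
Qed.

(** The only outcomes with nonzero amplitude when everybody but [i] plays A: [b] is the bit of [i],
    [c] the common bit of the others. *)
Definition bits_dev n (i : 'I_n) (b c : bool) : bitstring n :=
  [ffun j => if j == i then b else c].

Lemma bits_dev_inj n (i : 'I_n) :
  (2 <= n)%N -> injective (fun bc => bits_dev i bc.1 bc.2).
Proof.
move=> n2 [b c] [b' c'] /ffunP /= E.
have := E i; rewrite !ffunE eqxx => ->; congr (_, _).
by have [j /negPf ji] := other_player i n2; have := E j; rewrite !ffunE ji.
Qed.

Lemma bits_dev_id n (i : 'I_n) (b : bool) : bits_dev i b b = [ffun => b].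
Proof. by apply/ffunP => j; rewrite !ffunE if_same. Qed.

Lemma payoff_bits_dev (R : realType) n (i : 'I_n) (b c : bool) :
  (2 <= n)%N ->
  payoff_VD R i (bits_dev i b c) =
    if b then (if c then 2 - n%:R^-1 else 1) else if c then 2 else 0.
Proof.
move=> n2; have [j ji] := other_player i n2.
rewrite /payoff_VD /wt ffunE eqxx; case: b; case: c.
- rewrite (_ : [set _ | _] = setT) ?cardsT ?card_ord //.
  by apply/setP => k; rewrite !inE ffunE if_same.
- rewrite (_ : [set _ | _] = [set i]) ?cards1 ?invr1 ?addrK //.
  by apply/setP => k; rewrite !inE ffunE; case: eqP.
- rewrite (_ : (0 < _)%N) ?mulr1 //; apply/card_gt0P; exists j.
  by rewrite inE ffunE (negPf ji).
- rewrite (_ : [set _ | _] = set0) ?cards0 ?mulr0 //.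
  by apply/setP => k; rewrite !inE ffunE if_same.
Qed.

(** * Kets, bras and the entangler J *)

Section Adjoint.
Variable C : numClosedFieldType.

Lemma adj_mul m n p (A : 'M[C]_(m, n)) (B : 'M[C]_(n, p)) :
  B^t* *m A^t* = (A *m B)^t*.
Proof. by rewrite trmx_mul map_mxM. Qed.

(** Shaped after the right-hand side of [Jmx_ket], to turn that ket into a bra. *)
Lemma adj_combine m n (a b : C) (A B : 'M[C]_(m, n)) :
  (a *: (A - b *: B))^t* = a^* *: (A^t* + (- b^*) *: B^t*).
Proof. by apply/matrixP => i j; rewrite !mxE rmorphM rmorphB rmorphM mulNr. Qed.
End Adjoint.

Section Amplitudes.
Variable R : realType.

Lemma normc_sqr (a b : R) :
  ComplexField.Normc.normc (a +i* b) ^+ 2 = a ^+ 2 + b ^+ 2.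
Proof. by rewrite /= sqr_sqrtr // addr_ge0 // sqr_ge0. Qed.

Lemma mulcE (a b c d : R) :
  (a +i* b) * (c +i* d) = (a * c - b * d) +i* (a * d + b * c).
Proof. by []. Qed.

Lemma addcE (a b c d : R) : (a +i* b) + (c +i* d) = (a + c) +i* (b + d).
Proof. by []. Qed.

Lemma oppcE (a b : R) : - (a +i* b) = - a -i* b.
Proof. by []. Qed.

Lemma adj_ket_mul_ket n (M : 'M[R[i]]_#|bitstring n|) (x y : bitstring n) :
  ((ket R x)^t* *m M *m ket R y) 0 0 = M (enum_rank x) (enum_rank y).
Proof. by rewrite /ket trmx_delta map_delta_mx -rowE -colE !mxE. Qed.

Lemma tensorE n (M : 'I_n -> 'M[R[i]]_2) (x y : bitstring n) :
  tensor M (enum_rank x) (enum_rank y)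
  = \prod_(j < n) M j (bit_ord (x j)) (bit_ord (y j)).
Proof. by rewrite mxE !enum_rankK. Qed.

(** The scalar picked up by |x> under the tensor power of Y, since Y|0> = i|1> and Y|1> = -i|0>. *)
Definition phaseY n (x : bitstring n) : R[i] :=
  \prod_(j < n) if x j then - 'i%C else 'i%C.

Lemma tensorY_ket n (x : bitstring n) :
  tensor (fun _ : 'I_n => pauliY R) *m ket R x
  = phaseY x *: ket R (bits_compl x).
Proof.
apply/matrixP => a b; rewrite -colE !mxE (ord1 b) eqxx andbT enum_rankK.
have -> : (a == enum_rank (bits_compl x)) = (enum_val a == bits_compl x).
  by rewrite -{1}(enum_valK a) (inj_eq enum_rank_inj).
case: eqVneq => [->|neq_ax].
  rewrite mulr1; apply: eq_bigr => j _; rewrite ffunE.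
  by case: (x j); rewrite /= mxE.
(* A string other than the complement of [x] agrees with [x] at some bit, where the zero diagonal of
   Y kills the product. *)
have [j /eqP ajx] : exists j, (enum_val a : bitstring n) j == x j.
  apply/existsP; apply: contraNT neq_ax; rewrite negb_exists => /forallP neq_ax.
  apply/eqP/ffunP => j; rewrite ffunE; move: (neq_ax j).
  by case: (enum_val a j); case: (x j).
by rewrite mulr0 (bigD1 j) //= ajx; case: (x j); rewrite mxE /= mul0r.
Qed.

Lemma Jmx_ket n (x : bitstring n) :
  Jmx R n *m ket R x = ((Num.sqrt 2)^-1)%:C
    *: (ket R x - ('i%C * phaseY x) *: ket R (bits_compl x)).
Proof.
by rewrite /Jmx -scalemxAl mulmxBl mul1mx -scalemxAl tensorY_ket scalerA.
Qed.

Lemma conjE (a b : R) : Num.conj (a +i* b) = a -i* b.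
Proof. by []. Qed.

(** Complementing swaps i and -i in every factor and conjugation swaps them back, so only the
    leading i changes sign. *)
Lemma conj_iphaseY n (x : bitstring n) :
  Num.conj ('i%C * phaseY (bits_compl x)) = - ('i%C * phaseY x).
Proof.
rewrite rmorphM rmorph_prod -mulNr; congr (_ * _); first by simpc.
apply: eq_bigr => j _; rewrite ffunE.
by case: (x j); rewrite /= ?conjE; simpc; rewrite ?conjE ?opprK.
Qed.

Lemma conj_real (a : R) : Num.conj a%:C = a%:C.
Proof. exact: conjc_real. Qed.

(** J|0...0> and the bra of J applied to the complement of [x] are each a combination of two basis
    vectors; expanding gives four matrix entries [T y z] of the tensor product of the players'
    unitaries. *)
Lemma amplitudeE n (s : 'I_n -> strategy R) (x : bitstring n)
    (T := fun y z : bitstring n => \prod_(j < n)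
       Umx (val (s j)).1 (val (s j)).2 (bit_ord (y j)) (bit_ord (z j))) :
  amplitude s x = (2^-1)%:C *
    (T (bits_compl x) (bits0 n) - 'i%C * 'i%C ^+ n * T (bits_compl x) (bits1 n)
     + 'i%C * phaseY x * (T x (bits0 n) - 'i%C * 'i%C ^+ n * T x (bits1 n))).
Proof.
have sqrt2 : ((Num.sqrt 2)^-1)%:C * ((Num.sqrt 2)^-1)%:C = (2^-1)%:C :> R[i].
  by rewrite -rmorphM -invfM -expr2 sqr_sqrtr.
have phase0 : phaseY (bits0 n) = 'i%C ^+ n.
  rewrite /phaseY (eq_bigr (fun=> 'i%C)); last by move=> j _; rewrite ffunE.
  by rewrite prodr_const card_ord.
have compl0 : bits_compl (bits0 n) = bits1 n.
  by apply/ffunP => j; rewrite !ffunE.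
have bra_J : (ket R (bits_compl x))^t* *m (Jmx R n)^t*
    = ((Num.sqrt 2)^-1)%:C *: ((ket R (bits_compl x))^t*
      + ('i%C * phaseY x) *: (ket R x)^t*).
  rewrite adj_mul Jmx_ket bits_complK adj_combine conj_iphaseY opprK.
  by rewrite conj_real.
rewrite /amplitude bra_J -mulmxA Jmx_ket compl0 phase0.
rewrite -!scalemxAl -scalemxAr scalerA sqrt2.
rewrite !(mulmxDl, mulmxDr, mulmxN) -!scalemxAl -!scalemxAr.
have braket y z : ((ket R y)^t* *m tensor
    (fun j => Umx (val (s j)).1 (val (s j)).2) *m ket R z) 0 0 = T y z.
  by rewrite adj_ket_mul_ket tensorE.
rewrite 2!mxE; congr (_ * _); rewrite -!braket.
do 4 move: (_ *m _ *m _) => ?.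
by rewrite !mxE; ring.
Qed.

(** * Outcome probabilities after a deviation of one player *)

Lemma prod_unilateral n (i : 'I_n) (F : 'I_n -> R[i]) (a : R[i]) :
  (forall j, j != i -> F j = a) -> \prod_(j < n) F j = F i * a ^+ n.-1.
Proof.
move=> Fa; rewrite (bigD1 i) //= (eq_bigr (fun=> a)) //; congr (_ * _).
by rewrite prodr_const (eq_card (B := predC1 i)) // cardC1 card_ord.
Qed.

(** The sign is left existential because the probabilities do not depend on it. *)
Lemma imaginary_exp (m : nat) :
  exists e : bool, 'i%C ^+ m = (-1) ^+ e * 'i%C ^+ odd m :> R[i].
Proof.
exists (odd m./2); rewrite signr_odd -{1}(odd_double_half m) addnC exprD.
by rewrite -mul2n exprM sqr_i.
Qed.

Lemma Umx_A : Umx (0 : R) (pi / 2) = mx2 'i%C 0 0 (- 'i%C).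
Proof.
rewrite /Umx mul0r cos0 sin0 /expi cosN sinN cos_pihalf sin_pihalf.
by congr mx2; simpc.
Qed.

Definition agrees_A_off n (i : 'I_n) (s : 'I_n -> strategy R) :=
  forall j, j != i -> s j = stratA R.

Lemma prod_Umx_bits_dev n (i : 'I_n) (s : 'I_n -> strategy R)
    (y z : bitstring n) (yc zc : bool) :
  agrees_A_off i s ->
  (forall j, j != i -> y j = yc) -> (forall j, j != i -> z j = zc) ->
  \prod_(j < n) Umx (val (s j)).1 (val (s j)).2
     (bit_ord (y j)) (bit_ord (z j))
  = Umx (val (s i)).1 (val (s i)).2 (bit_ord (y i)) (bit_ord (z i))
    * (mx2 'i%C 0 0 (- 'i%C) (bit_ord yc) (bit_ord zc)) ^+ n.-1.
Proof.
move=> sA yP zP; apply: prod_unilateral => j ji.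
by rewrite sA // yP // zP // Umx_A.
Qed.

(** If [b == c], only the diagonal entries of the unitary of [i] survive, and their phases interfere
    to cos phi or sin phi. Otherwise the two off-diagonal entries survive and either add up or
    cancel. *)
Lemma vol_prob_bits_dev n (i : 'I_n) (s : 'I_n -> strategy R) (b c : bool)
    (theta := (val (s i)).1) (phi := (val (s i)).2) :
  (2 <= n)%N -> agrees_A_off i s ->
  vol_prob s (bits_dev i b c) =
    (if b == c then (if odd n (+) b then sin phi else cos phi) * cos (theta / 2)
     else if odd n (+) b then sin (theta / 2) else 0) ^+ 2.
Proof.
(* With n = k + 2 the exponent [n.-1] is positive, so powers of the off-diagonal zeros of A
   vanish. *)
case: n i s @theta @phi => [|[|k]] // i s theta phi _ sA.
rewrite /vol_prob amplitudeE.
have devP j : j != i -> bits_dev i b c j = c by rewrite ffunE => /negPf->.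
have cdevP j : j != i -> bits_compl (bits_dev i b c) j = ~~ c.
  by move=> ji; rewrite ffunE devP.
have zeroP j : j != i -> bits0 k.+2 j = false by rewrite ffunE.
have oneP j : j != i -> bits1 k.+2 j = true by rewrite ffunE.
rewrite (prod_Umx_bits_dev sA cdevP zeroP) (prod_Umx_bits_dev sA cdevP oneP).
rewrite (prod_Umx_bits_dev sA devP zeroP) (prod_Umx_bits_dev sA devP oneP).
rewrite -/theta -/phi.
rewrite /phaseY (prod_unilateral (i := i) (a := if c then - 'i%C else 'i%C)).
  2: by move=> j ji; rewrite devP.
rewrite [bits_compl _ i]ffunE [bits_dev _ _ _ i]ffunE !ffunE eqxx.
rewrite /Umx /expi cosN sinN.
have [e ik] := imaginary_exp k.+1.
have Nik : (- 'i%C) ^+ k.+1 = (-1) ^+ odd k.+1 * 'i%C ^+ k.+1 :> R[i].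
  by rewrite signr_odd (exprNn 'i%C).
have -> : odd k.+2 = ~~ odd k.+1 by [].
rewrite (exprS _ k.+1) !mxE.
move: (odd k.+1) ik Nik => o ik Nik.
have ii : 'i%C * 'i%C = -1 :> R[i] by rewrite -expr2 sqr_i.
(* With 'i ^+ n known from n mod 4, each of the 16 cases is explicit. *)
pose signE := (ii, expr0, expr1, mul0r, mulr0, mulrN, mulNr, mul1r, mulr1,
  mulN1r, mulrN1, subr0, addr0, add0r, oppr0, opprK).
case: c b {devP cdevP} => -[] /=; rewrite ?Nik ik ?expr0n /=;
  case: o {ik Nik} => /=; case: e.
all: rewrite !mulrA !signE.
all: move: (cos phi) (sin phi) (cos (theta / 2)) (sin (theta / 2)) => C S c t.
all: rewrite /real_complex_def.
all: rewrite !(mulcE, addcE, oppcE) !signE.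
all: rewrite normc_sqr.
all: by field.
Qed.

(** Two players other than [i] have different bits in [x], hence also in its complement. Against a
    constant string one of them mismatches, and its diagonal unitary annihilates each of the four
    products. *)
Lemma vol_prob_eq0 n (i : 'I_n) (s : 'I_n -> strategy R)
    (x : bitstring n) :
  (2 <= n)%N -> agrees_A_off i s -> (forall b c, x != bits_dev i b c) ->
  vol_prob s x = 0.
Proof.
move=> n2 sA xN; have [j0 j0i] := other_player i n2.
have [j ji xjj0] : exists2 j, j != i & x j != x j0.
  apply/exists_inP; apply: contraNT (xN (x i) (x j0)).
  rewrite negb_exists_in => /forall_inP x_const; apply/eqP/ffunP => j.
  rewrite ffunE; case: eqVneq => [->//|/x_const].
  by rewrite negbK => /eqP.
have prod0 (y z : bitstring n) j1 : j1 != i -> y j1 != z j1 ->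
    \prod_(j < n) Umx (val (s j)).1 (val (s j)).2
       (bit_ord (y j)) (bit_ord (z j)) = 0.
  move=> j1i yz; rewrite (bigD1 j1) //= sA // Umx_A.
  by case: (y j1) (z j1) yz => -[] // _; rewrite mxE /= mul0r.
have prodN0 (y : bitstring n) (d : bool) : y j != y j0 ->
    \prod_(j < n) Umx (val (s j)).1 (val (s j)).2
       (bit_ord (y j)) (bit_ord (([ffun => d] : bitstring n) j)) = 0.
  move=> yjj0; have [yjd|yjd] := eqVneq (y j) d.
    by apply: (prod0 _ _ j0) => //; rewrite ffunE -yjd eq_sym.
  by apply: (prod0 _ _ j) => //; rewrite ffunE.
have cxjj0 : bits_compl x j != bits_compl x j0.
  by rewrite !ffunE (inj_eq negb_inj).
rewrite /vol_prob amplitudeE !prodN0 // !mulr0 subr0 mulr0 addr0 mulr0.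
by rewrite ComplexField.Normc.normc0 expr0n.
Qed.

End Amplitudes.

(** * Payoffs and equilibrium *)

Lemma sum_bool2 (V : nmodType) (F : bool * bool -> V) :
  \sum_bc F bc = F (true, true) + F (true, false)
                + (F (false, true) + F (false, false)).
Proof.
rewrite (eq_bigr (fun bc => F (bc.1, bc.2))); last by case.
by rewrite -(pair_bigA _ (fun b c => F (b, c))) /= !big_bool.
Qed.

(** The sin^2 mass lies on [i] volunteering alone (payoff 1) for even n, and on everybody but [i]
    volunteering (payoff 2) for odd n. The second term comes from all volunteering; all abstaining
    pays 0. *)
Lemma payoff_unilateral (R : realType) n (i : 'I_n) (s : 'I_n -> strategy R)
    (theta := (val (s i)).1) (phi := (val (s i)).2) :
  (2 <= n)%N -> agrees_A_off i s ->
  payoff_QVD i s =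
    (if odd n then 2 else 1) * sin (theta / 2) ^+ 2
    + (2 - n%:R^-1)
      * ((if odd n then cos phi else sin phi) * cos (theta / 2)) ^+ 2.
Proof.
move=> n2 sA; rewrite /payoff_QVD.
pose dev (bc : bool * bool) := bits_dev i bc.1 bc.2.
(* Outcomes outside the image of [dev] have probability 0; by injectivity the rest is a sum over
   pairs of bits. *)
rewrite (bigID (mem (dev @: setT))) /= [X in _ + X]big1 ?addr0; last first.
  move=> x xNdev; rewrite (vol_prob_eq0 n2 sA) ?mulr0 // => b c.
  by apply: contraNneq xNdev => ->; apply/imsetP; exists (b, c); rewrite ?inE.
rewrite big_imset /=; last by move=> bc bc' _ _; exact: bits_dev_inj.
rewrite (eq_bigl predT) => [|bc]; last by rewrite inE.
rewrite sum_bool2 /dev /=.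
rewrite !(payoff_bits_dev R i _ _ n2) !(vol_prob_bits_dev _ _ n2 sA) /=.
by case: (odd n) => /=; rewrite -/theta -/phi; ring.
Qed.

Lemma payoff_profileA (R : realType) n (i : 'I_n) :
  (2 <= n)%N ->
  payoff_QVD i (profileA R n) = (2 - n%:R^-1) * (~~ odd n)%:R.
Proof.
move=> n2; rewrite payoff_unilateral //= mul0r sin0 cos0 cos_pihalf sin_pihalf.
by case: (odd n) => /=; ring.
Qed.

Lemma strategy_set0 (R : realType) : in_strategy_set (0 : R, 0).
Proof. by have := pi_gt0 R; rewrite /in_strategy_set /=; lra. Qed.

Theorem theorem10 (R : realType) (n : nat) (n_ge2 : (2 <= n)%N) :
  [/\ forall x : bitstring n,
        vol_prob (profileA R n) x
        = (~~ odd n)%:R * (x == bits1 n)%:R + (odd n)%:R * (x == bits0 n)%:R,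
      forall a : 'I_n,
        payoff_QVD a (profileA R n) = (2 - n%:R^-1) * (~~ odd n)%:R,
      ~~ odd n -> is_nash (@payoff_QVD R n) (profileA R n)
    & odd n -> ~ is_nash (@payoff_QVD R n) (profileA R n)].
Proof.
have volunteer_payoff_ge1 : 1 <= 2 - n%:R^-1 :> R.
  suff : n%:R^-1 <= 1 :> R by lra.
  by rewrite invf_le1 ?ler1n ?ltr0n ltnW.
have devA i t : agrees_A_off i [eta profileA R n with i |-> t].
  by move=> j /= /negPf->.
split=> [x|a|even_n i t _|odd_n].
(* The profile is viewed as a trivial deviation of an arbitrary player; [n_ge2] unfolds to 1 < n, so
   player 1 serves. *)
- pose i : 'I_n := Ordinal n_ge2.
  have bitsE b c d : (bits_dev i b c == [ffun => d]) = (b == d) && (c == d).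
    by rewrite -(bits_dev_id i d) (inj_eq (bits_dev_inj (i := i) n_ge2)
      (b, c) (d, d)).
  have [[[b c] /eqP->]|xNdev] := existsP (P := fun bc => x == bits_dev i bc.1 bc.2).
    rewrite vol_prob_bits_dev // !bitsE /= mul0r sin0 cos0 cos_pihalf sin_pihalf.
    by case: b c (odd n) => -[] [] /=; ring.
  have xN b c : x != bits_dev i b c by apply/negP => ?; apply: xNdev; exists (b, c).
  rewrite (vol_prob_eq0 n_ge2 (i := i)) //.
  (* The all-ones and all-zeros strings are themselves of the form [bits_dev], so both brackets are
     0. *)
  have := (xN true true, xN false false); rewrite !bits_dev_id => -[].
  by rewrite -/(bits0 n) -/(bits1 n) => /negPf-> /negPf->; rewrite !mulr0 addr0.
- exact: payoff_profileA.
- rewrite payoff_profileA // even_n mulr1 payoff_unilateral // (negPf even_n).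
  set th := (val _).1; set ph := (val _).2.
  rewrite exprMn; set w := _ - _ in volunteer_payoff_ge1 *.
  (* The loss of the deviator is written as a combination of squares with coefficients w - 1 and w,
     nonnegative because w >= 1. *)
  suff -> : 1 * sin (th / 2) ^+ 2 + w * (sin ph ^+ 2 * cos (th / 2) ^+ 2)
      = w - ((w - 1) * sin (th / 2) ^+ 2 + w * (cos ph * cos (th / 2)) ^+ 2).
    by rewrite gerBl addr_ge0 // mulr_ge0 ?sqr_ge0 //; lra.
  by rewrite !sin2cos2; ring.
- pose i : 'I_n := Ordinal n_ge2.
  (* Setting phi to 0 replaces cos(pi/2) = 0 by cos 0 = 1 in the odd payoff, raising it from 0 to 2
     - 1/n. *)
  pose t : strategy R := exist _ (0, 0) (strategy_set0 R).
  have t_neq : t != profileA R n i.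
    rewrite -val_eqE /= xpair_eqE eqxx /= eq_sym.
    by rewrite mulf_neq0 ?invr_eq0 ?pnatr_eq0 // gt_eqF // pi_gt0.
  move=> /(_ i t t_neq); rewrite payoff_profileA // odd_n mulr0.
  rewrite payoff_unilateral // odd_n /= ?eqxx /= mul0r sin0 !cos0.
  by rewrite expr0n mulr0 add0r mulr1 expr1n mulr1; lra.
Qed.
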